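(* If $S$ is a quasi-countable $E$-unitary inverse semigroup whose maximal group image has Property A, then $S$ has Property A.
   Context: An inverse semigroup is a semigroup $S$ in which every $s$ has a unique $s^{-1}$ with $ss^{-1}s=s$ and $s^{-1}ss^{-1}=s^{-1}$. $E(S)$ is its set of idempotents. Two elements $s,t$ are $\mathcal{R}$-related iff $ss^{-1}=tt^{-1}$. $S$ is quasi-countable if there is a countable set $X$ of elements such that $S$ is generated, under multiplication and inversion, by $X\cup E(S)$. The maximal group image is the quotient group $S/\sigma$, where $\sigma$ is the least congruence identifying all idempotents. $S$ is $E$-unitary if the natural homomorphism $S\to S/\sigma$ is injective on each $\mathcal{R}$-class (equivalently, the preimage of $1$ is $E(S)$). An extended metric is a function $d\colon X\times X\to[0,\infty]$ satisfying the usual metric axioms; its components are the classes of the relation $d(x,y)<\infty$; $B(x,r)$ is the ball of radius $r$ around $x$. An extended metric space is uniformly discrete if there is a positive lower bound on the distance between distinct points, and has bounded geometry if for each $r>0$ there is a finite upper bound on the cardinality of balls of radius $r$. A standard metric on a quasi-countable inverse semigroup $S$ is a uniformly discrete extended metric $d$ whose components are exactly the $\mathcal{R}$-classes of $S$, which is left subinvariant ($d(xs,xt)\le d(s,t)$ for all $s,t,x\in S$) and proper (for every $r\ge 0$ there is a finite $F\subseteq S$ such that $y\in xF$ for every pair $x\ne y$ in $S$ with $d(x,y)\le r$). Every quasi-countable inverse semigroup has a standard metric, unique up to coarse equivalence. (For a countable group this is a left invariant metric of bounded geometry.) Property A: a uniformly discrete extended metric space $(X,d)$ with bounded geometry has Property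 A if for every $\epsilon>0$ and $R>0$ there exist a number $L>0$ and a map $x\mapsto \xi_x$ from $X$ to the set of non-negative functions on $X$ of $\ell_1$-norm $1$ such that (1) $\|\xi_x-\xi_y\|_1\le\epsilon$ whenever $d(x,y)\le R$, and (2) the support of $\xi_x$ is contained in $B(x,L)$ for all $x\in X$. Property A of a quasi-countable inverse semigroup (in particular of a countable group) means Property A with respect to a standard metric; it is invariant under coarse equivalence, so does not depend on the choice of standard metric. *)

(* Defs.v *)
From HB Require Import structures.
From mathcomp Require Import all_boot all_order all_algebra.
From mathcomp Require Import all_classical all_reals all_analysis.

Set Implicit Arguments.
Unset Strict Implicit.
Unset Printing Implicit Defensive.

Import Order.TTheory GRing.Theory Num.Theory.

Local Open Scope classical_set_scope.
Local Open Scope quotient_scope.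
Local Open Scope group_scope.

(* The library's inverse operation lives on [baseGroupType], which has a unit;
   hence the separate [sinv].  The last axiom is uniqueness of the inverse. *)
HB.mixin Record Semigroup_isInverse S of Semigroup S := {
  sinv : S -> S;
  mulsVs : forall s : S, s * sinv s * s = s;
  mulVsV : forall s : S, sinv s * s * sinv s = sinv s;
  sinv_uniq : forall s t : S, s * t * s = s -> t * s * t = t -> t = sinv s
}.

#[short(type="inverseSemigroupType")]
HB.structure Definition InverseSemigroup :=
  {S of Semigroup_isInverse S & Semigroup S}.

Section InverseSemigroups.
Variable S : inverseSemigroupType.
Implicit Types s t e f : S.

Definition idempotents : set S := [set e | e * e = e].

Definition greenR s t : Prop := s * sinv s = t * sinv t.

Definition inverse_subsemigroup (T : set S) : Prop :=
  (forall s t, T s -> T t -> T (s * t)) /\ (forall s, T s -> T (sinv s)).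

Definition quasi_countable : Prop :=
  exists X : set S,
    countable X /\ smallest inverse_subsemigroup (X `|` idempotents) = setT.

Definition congruence (r : rel S) : Prop :=
  [/\ reflexive r, symmetric r, transitive r
    & forall s s' t t', r s s' -> r t t' -> r (s * t) (s' * t')].

Definition sigma : rel S := fun s t =>
  `[< forall r : rel S, congruence r ->
        (forall e f, idempotents e -> idempotents f -> r e f) -> r s t >].

Lemma sigma_congruence : congruence sigma.
Proof.
split.
- by move=> s; apply/asboolP => r [rr _ _ _] _.
- move=> s t; apply/asboolP/asboolP => h r rc ri;
    by case: (rc) => _ rs _ _; rewrite rs; apply: h.
- move=> t s u /asboolP st /asboolP tu; apply/asboolP => r rc ri.
  by case: (rc) => _ _ rt _; apply: (rt t); [apply: st|apply: tu].
- move=> s s' t t' /asboolP ss /asboolP tt; apply/asboolP => r rc ri.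
  by case: (rc) => _ _ _; apply; [apply: ss|apply: tt].
Qed.

Lemma sigma_idempotents e f : idempotents e -> idempotents f -> sigma e f.
Proof. by move=> ie jf; apply/asboolP => r _; apply. Qed.

Let sigma_refl : reflexive sigma. Proof. by case: sigma_congruence. Qed.
Let sigma_sym : symmetric sigma. Proof. by case: sigma_congruence. Qed.
Let sigma_trans : transitive sigma. Proof. by case: sigma_congruence. Qed.

Canonical sigma_equiv := EquivRel sigma sigma_refl sigma_sym sigma_trans.

Definition max_group_image := {eq_quot sigma_equiv}.
HB.instance Definition _ := Choice.on max_group_image.
HB.instance Definition _ := EqQuotient.on max_group_image.

Definition to_group (s : S) : max_group_image := \pi_max_group_image s.

Lemma to_groupP s t : to_group s = to_group t <-> sigma s t.
Proof.
by split=> [/eqmodP|h]; last exact/eqmodP.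
Qed.

Definition E_unitary : Prop :=
  forall s t, greenR s t -> to_group s = to_group t -> s = t.

Implicit Types p q u : max_group_image.

Definition mgi_mul p q : max_group_image := to_group (repr p * repr q).
Definition mgi_inv p : max_group_image := to_group (sinv (repr p)).

Lemma to_groupK p : to_group (repr p) = p.
Proof. exact: reprK. Qed.

Lemma to_groupM s t : to_group (s * t) = mgi_mul (to_group s) (to_group t).
Proof.
apply/to_groupP; case: sigma_congruence => _ _ _; apply;
  by apply/to_groupP; rewrite to_groupK.
Qed.

Lemma mgi_mulA : associative mgi_mul.
Proof.
move=> p q u; rewrite -(to_groupK p) -(to_groupK q) -(to_groupK u).
by rewrite -!to_groupM mulgA.
Qed.

HB.instance Definition _ := isSemigroup.Build max_group_image mgi_mulA.

Lemma idem_mulsV s : idempotents (s * sinv s).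
Proof. by rewrite /idempotents /= mulgA mulsVs. Qed.

Lemma idem_mulVs s : idempotents (sinv s * s).
Proof. by rewrite /idempotents /= mulgA mulVsV. Qed.

Lemma to_group_idem e f :
  idempotents e -> idempotents f -> to_group e = to_group f.
Proof. by move=> ie jf; apply/to_groupP; exact: sigma_idempotents. Qed.

Lemma mgi_mul1 e p : idempotents e -> to_group e * p = p.
Proof.
move=> ie; rewrite (to_group_idem ie (idem_mulsV (repr p))).
transitivity (to_group (repr p * sinv (repr p) * repr p)).
  by rewrite (to_groupM (_ * _)) to_groupK.
by rewrite mulsVs to_groupK.
Qed.

Lemma mgi_mulr1 e p : idempotents e -> p * to_group e = p.
Proof.
move=> ie; rewrite (to_group_idem ie (idem_mulVs (repr p))).
transitivity (to_group (repr p * (sinv (repr p) * repr p))).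
  by rewrite (to_groupM _ (_ * _)) to_groupK.
by rewrite mulgA mulsVs to_groupK.
Qed.

Lemma mgi_mulV p : p * mgi_inv p = to_group (repr p * sinv (repr p)).
Proof. by rewrite to_groupM to_groupK. Qed.

Lemma mgi_mulVr p : mgi_inv p * p = to_group (sinv (repr p) * repr p).
Proof. by rewrite to_groupM to_groupK. Qed.

Lemma mgi_mulsVs p : p * mgi_inv p * p = p.
Proof. by rewrite mgi_mulV mgi_mul1//; exact: idem_mulsV. Qed.

Lemma mgi_mulVsV p : mgi_inv p * p * mgi_inv p = mgi_inv p.
Proof. by rewrite mgi_mulVr mgi_mul1//; exact: idem_mulVs. Qed.

Lemma mgi_inv_uniq p q : p * q * p = p -> q * p * q = q -> q = mgi_inv p.
Proof.
move=> pqp _.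
have qp : q * p = mgi_inv p * p.
  transitivity (mgi_inv p * (p * q * p)); last by rewrite pqp.
  by rewrite 2!mulgA mgi_mulVr (mgi_mul1 q (idem_mulVs (repr p))).
rewrite -[LHS](@mgi_mulr1 (repr p * sinv (repr p))); last exact: idem_mulsV.
by rewrite -mgi_mulV mulgA qp mgi_mulVsV.
Qed.

HB.instance Definition _ := Semigroup_isInverse.Build max_group_image
  mgi_mulsVs mgi_mulVsV mgi_inv_uniq.

(* [max_group_image] is a group, with unit [p * sinv p] for any [p]. It only
   gets an [inverseSemigroupType] structure because [S] may be empty. *)
Lemma max_group_image_group p q :
  [/\ p * sinv p = q * sinv q, sinv p * p = p * sinv p,
      (p * sinv p) * q = q & q * (p * sinv p) = q].
Proof.
have ip := idem_mulsV (repr p); have iq := idem_mulsV (repr q).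
have jp := idem_mulVs (repr p).
split; rewrite ?mgi_mulV ?mgi_mulVr ?mgi_mul1 ?mgi_mulr1 //.
- exact: to_group_idem.
- exact: to_group_idem.
Qed.

End InverseSemigroups.

Local Close Scope group_scope.
Local Open Scope ring_scope.
Local Open Scope ereal_scope.

Section ExtendedMetrics.
Variables (R : realType) (X : choiceType).
Implicit Type d : X -> X -> \bar R.

Definition extended_metric d : Prop :=
  [/\ forall x y, 0 <= d x y,
      forall x y, d x y = 0 <-> x = y,
      forall x y, d x y = d y x
    & forall x y z, d x z <= d x y + d y z].

Definition eball d (x : X) (r : R) : set X := [set y | d x y <= r%:E].

Definition uniformly_discrete d : Prop :=
  exists2 c : R, (0 < c)%R & forall x y, x <> y -> c%:E <= d x y.

Definition bounded_geometry d : Prop :=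
  forall r : R, (0 < r)%R -> exists n : nat, forall x, (eball d x r #<= `I_n)%card.

Definition l1norm (f : X -> R) : \bar R := \esum_(x in [set: X]) `|f x|%:E.

Definition property_A d : Prop :=
  [/\ extended_metric d, uniformly_discrete d, bounded_geometry d
    & forall eps r : R, (0 < eps)%R -> (0 < r)%R ->
      exists2 L : R, (0 < L)%R & exists xi : X -> X -> R,
        [/\ forall x y, (0 <= xi x y)%R,
            forall x, l1norm (xi x) = 1,
            forall x y, d x y <= r%:E ->
              l1norm (fun z => xi x z - xi y z)%R <= eps%:E
          & forall x y, xi x y <> 0%R -> eball d x L y]].

End ExtendedMetrics.

Section SemigroupPropertyA.
Variables (R : realType) (S : inverseSemigroupType).
Implicit Type d : S -> S -> \bar R.

Definition components_are_R_classes d : Prop :=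
  forall s t, d s t < +oo <-> greenR s t.

Definition left_subinvariant d : Prop :=
  forall s t x : S, d (x * s)%g (x * t)%g <= d s t.

Definition proper_metric d : Prop :=
  forall r : R, (0 <= r)%R ->
    exists2 F : set S, finite_set F &
      forall x y, x <> y -> d x y <= r%:E -> exists2 f, F f & y = (x * f)%g.

Definition standard_metric d : Prop :=
  [/\ extended_metric d, uniformly_discrete d, components_are_R_classes d,
      left_subinvariant d & proper_metric d].

Definition has_property_A : Prop :=
  exists d : S -> S -> \bar R, standard_metric d /\ property_A d.

End SemigroupPropertyA.

(* Main.v *)
(* Let d be a word metric on S: right multiplication by generators inside
   R-classes, the n-th generator having length n + 1. The map f : S -> G to the
   maximal group image is injective on R-classes (E-unitarity) and sends pairs at
   d-distance <= r to pairs at bounded distance, but it is not a coarse embedding,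
   so the functions xi of G cannot simply be pulled back.

   Instead, round xi: correlated sampling turns it into a random labelling lab of
   G with lab p in supp xi_p and Pr [lab p <> lab q] <= 2 |xi_p - xi_q|_1. In S,
   join x and y when d x y <= r and lab (f x) = lab (f y). A component lies in one
   R-class and f maps it injectively into a ball of G, so the components have
   bounded size, hence bounded diameter. Choosing a root in each component gives a
   random map c : S -> S with d x (c x) bounded and Pr [c x <> c y] small when
   d x y <= r; the law of c x is the function wanted at x. This is carried out
   over the finite subsets of S, followed by a limit along an ultrafilter. *)
Require Import Defs.
From HB Require Import structures.
From mathcomp Require Import all_boot all_order all_algebra all_fingroup.
From mathcomp Require Import finmap.
From mathcomp Require Import all_classical all_reals all_analysis.
From mathcomp Require Import ring lra.

Set Implicit Arguments.
Unset Strict Implicit.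
Unset Printing Implicit Defensive.

Import Order.TTheory GRing.Theory Num.Theory.
Import numFieldNormedType.Exports.

(** * Correlated sampling *)

Section MinHash.
Variable V : finType.
Implicit Types (s : {perm V}) (A B : {set V}) (v w : V).

(** The permutation [s] stands for a random total order on [V], in which [v] has rank
    [enum_rank (s v)]. *)
Definition is_min s A v :=
  (v \in A) && [forall a in A, (enum_rank (s v) <= enum_rank (s a))%N].

Lemma is_min_uniq s A v w : is_min s A v -> is_min s A w -> v = w.
Proof.
move=> /andP[vA /forall_inP vmin] /andP[wA /forall_inP wmin].
apply: (@perm_inj _ s); apply: enum_rank_inj; apply: val_inj => /=.
by apply/eqP; rewrite eqn_leq vmin//= wmin.
Qed.

Lemma exists_is_min s A v0 : v0 \in A -> exists v, is_min s A v.
Proof.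
move=> v0A; pose r v := nat_of_ord (enum_rank (s v)).
case: (@arg_minnP _ v0 (fun v => v \in A) r v0A) => v vA vmin.
by exists v; rewrite /is_min vA; apply/forall_inP => a /vmin.
Qed.

Lemma is_min_sub s A B v :
  A \subset B -> v \in A -> is_min s B v -> is_min s A v.
Proof.
move=> /fintype.subsetP AB vA /andP[_ /forall_inP vmin]; rewrite /is_min vA.
by apply/forall_inP => a /AB /vmin.
Qed.

(* Composing with the transposition of [v] and [w] exchanges the two events. *)
Lemma card_is_min_le A v w : v \in A -> w \in A ->
  (#|[set s | is_min s A v]| <= #|[set s | is_min s A w]|)%N.
Proof.
move=> vA wA; rewrite -(card_imset _ (@mulgI _ (tperm v w))).
apply/subset_leq_card/fintype.subsetP => _ /imsetP[s + ->].
rewrite !inE => /andP[_ /forall_inP vmin]; rewrite /is_min wA /=.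
apply/forall_inP => a aA; rewrite !permM tpermR; apply: vmin.
by case: tpermP.
Qed.

(** Every permutation has exactly one minimum in [A], and by symmetry each element of [A] is the
    minimum equally often: the minimum is uniformly distributed on [A]. *)
Lemma card_is_min A v : v \in A ->
  (#|A| * #|[set s | is_min s A v]| = #|{: {perm V}}|)%N.
Proof.
move=> vA; rewrite -sum_nat_const.
transitivity (\sum_(w in A) #|[set s | is_min s A w]|)%N.
  by apply: eq_bigr => w wA; apply/eqP; rewrite eqn_leq !card_is_min_le.
transitivity (\sum_(w in A) \sum_(s : {perm V}) is_min s A w)%N.
  by apply: eq_bigr => w _; rewrite -sum1dep_card [RHS]big_mkcond/= [LHS]big_mkcond.
rewrite exchange_big /= -sum1_card; apply: eq_bigr => s _.
have [w smin] := exists_is_min s vA; have /andP[wA _] := smin.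
rewrite (bigD1 w) //= smin big1 // => u /andP[uA uw].
by apply/eqP; rewrite eqb0; apply: contra uw => /(is_min_uniq smin) ->.
Qed.

Definition argmin s A v0 := odflt v0 [pick v | is_min s A v].

Lemma argminE s A v0 v : is_min s A v -> argmin s A v0 = v.
Proof.
rewrite /argmin => sv; case: pickP => [w sw|/(_ v)]; last by rewrite sv.
exact: is_min_uniq sw sv.
Qed.

Lemma argmin_in s A v0 v : v \in A -> argmin s A v0 \in A.
Proof.
by move=> /(exists_is_min s)[w sw]; rewrite (argminE _ sw); case/andP: sw.
Qed.

(** A minimum of [A :|: B] lying in both sets is the minimum of each, so the two choices differ only
    if it falls in the symmetric difference. By uniformity this has probability |A Δ B| / |A ∪ B|;
    denominators are cleared. *)
Lemma card_argmin_neq A B v0 :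
  (#|[set s | argmin s A v0 != argmin s B v0]| * #|A :|: B| <=
   #|(A :\: B) :|: (B :\: A)| * #|{: {perm V}}|)%N.
Proof.
set D := _ :|: (_ :\: _); set N := [set s | _].
have DAB : D \subset A :|: B by rewrite finset.setUSS ?finset.subsetDl.
apply: (@leq_trans ((\sum_(v in D) #|[set s | is_min s (A :|: B) v]|)
  * #|A :|: B|)%N); last first.
  rewrite big_distrl /= -sum_nat_const; apply: leq_sum => v /(fintype.subsetP DAB) vAB.
  by rewrite mulnC card_is_min.
rewrite leq_mul2r; apply/orP; right.
apply: (@leq_trans #|\bigcup_(v in D) [set s | is_min s (A :|: B) v]|); last first.
  elim/big_ind2: _ => [|n1 A1 n2 A2 h1 h2|//]; rewrite ?cards0 //.
  by apply: leq_trans (leq_card_setU _ _) _; rewrite leq_add.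
apply/subset_leq_card/fintype.subsetP => s; rewrite inE => neq.
have [AB0|/set0Pn[v1 v1AB]] := eqVneq (A :|: B) finset.set0.
  move: AB0 neq => /eqP; rewrite finset.setU_eq0 => /andP[/eqP-> /eqP->].
  by rewrite eqxx.
have [v sv] := exists_is_min s v1AB.
apply/bigcupP; exists v; last by rewrite inE.
apply: contraNT neq => vD.
have /andP[vA vB] : (v \in A) && (v \in B).
  case/andP: sv => + _; move: vD; rewrite !inE.
  by case: (v \in A); case: (v \in B).
have sA := is_min_sub (finset.subsetUl A B) vA sv.
have sB := is_min_sub (finset.subsetUr A B) vB sv.
by rewrite (argminE _ sA) (argminE _ sB).
Qed.

End MinHash.

(** * Discretisation of probability vectors *)

Section Rounding.
Local Open Scope ring_scope.

Lemma card_ord_itv (M a b : nat) : (a <= M)%N ->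
  #|[set k : 'I_M | (b <= k < a)%N]| = (a - b)%N.
Proof.
move=> aM; rewrite -sum1dep_card.
rewrite -(big_mkord (fun k => (b <= k < a)%N) (fun=> 1%N)).
transitivity (\sum_(b <= k < a) 1)%N; last by rewrite sum_nat_const_nat muln1.
rewrite (big_nat_widen _ _ _ _ _ aM) (big_nat_widenl _ _ _ _ _ (leq0n b)).
by apply: eq_bigl => k; rewrite andbC.
Qed.

Lemma card_pair_dep (U K : finType) (P : U -> pred K) :
  #|[set z : U * K | P z.1 z.2]| = (\sum_u #|[set k | P u k]|)%N.
Proof.
rewrite -sum1dep_card -(pair_big_dep predT P (fun _ _ => 1%N)) /=.
by apply: eq_bigr => u _; rewrite sum1dep_card.
Qed.

Variable R : realType.

(* Correlated sampling: discretise [p x] to a subset of [U * 'I_M] and let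
   [lab s x] be its minimal element for the order shuffled by [s]. *)
Lemma correlated_sampling (T U : finType) (p : T -> U -> R) (eps : R) :
  0 < eps -> (forall x u, 0 <= p x u) -> (forall x, \sum_u p x u = 1) ->
  exists (W : finType) (lab : W -> T -> U),
    [/\ (0 < #|W|)%N, forall w x, p x (lab w x) != 0
      & forall x y, \sum_u `|p x u - p y u| <= eps ->
          #|[set w | lab w x != lab w y]|%:R <= 2 * eps * #|W|%:R].
Proof.
move=> eps0 p0 p1.
pose N : R := #|U|%:R.
(* [M] is the number of levels. Rounding down loses at most 1 in each of the [N] columns, so the
   final ratio is at most (M eps + N) / (M - N), and [NM] says that this is below 2 eps. *)
pose M := (Num.truncn (N * (2 + eps^-1))).+1.
have N0 : 0 <= N by rewrite ler0n.
have NM : N * (1 + 2 * eps) < eps * M%:R.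
  have -> : N * (1 + 2 * eps) = eps * (N * (2 + eps^-1)).
    by field; rewrite gt_eqF.
  rewrite ltr_pM2l //; apply: truncnS_gt.
pose a x u := Num.truncn (M%:R * p x u).
have Mp0 x u : 0 <= M%:R * p x u by rewrite mulr_ge0.
have p_le1 x u : p x u <= 1.
  by rewrite -(p1 x) (bigD1 u) //= lerDl sumr_ge0.
have aM x u : (a x u <= M)%N.
  rewrite -(ler_nat R); apply: le_trans (_ : M%:R * p x u <= _).
    by rewrite truncn_le.
  by rewrite ler_piMr.
have a_le x u : (a x u)%:R <= M%:R * p x u by rewrite truncn_le.
have a_gt x u : M%:R * p x u < (a x u)%:R + 1.
  by rewrite natr1; apply: truncnS_gt.
(* The region under the graph of [a x]: symmetric differences of such regions measure the l1
   distance, scaled by [M], up to an error [N]. *)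
pose A x := [set z : U * 'I_M | (z.2 < a x z.1)%N].
have cardA x : M%:R - N <= #|A x|%:R.
  have -> : #|A x| = (\sum_u a x u)%N.
    rewrite (card_pair_dep (fun u (k : 'I_M) => (k < a x u)%N)).
    by apply: eq_bigr => u _; rewrite -[RHS]subn0 -(card_ord_itv 0 (aM x u)).
  rewrite natr_sum lerBlDr /N -sum1_card natr_sum -big_split /=.
  rewrite [leLHS](_ : _ = \sum_u M%:R * p x u); last first.
    by rewrite -mulr_sumr p1 mulr1.
  by apply: ler_sum => u _; exact/ltW/a_gt.
have cardD x y : #|A x :\: A y| = (\sum_u (a x u - a y u))%N.
  transitivity #|[set z : U * 'I_M | (a y z.1 <= z.2 < a x z.1)%N]|.
    by apply: eq_card => z; rewrite !inE -leqNgt.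
  rewrite (card_pair_dep (fun u (k : 'I_M) => (a y u <= k < a x u)%N)).
  by apply: eq_bigr => u _; rewrite card_ord_itv.
have cardS x y : \sum_u `|p x u - p y u| <= eps ->
    #|(A x :\: A y) :|: (A y :\: A x)|%:R <= M%:R * eps + N.
  move=> pxy; apply: le_trans (_ : (#|A x :\: A y| + #|A y :\: A x|)%:R <= _).
    by rewrite ler_nat leq_card_setU.
  apply: le_trans (_ : M%:R * (\sum_u `|p x u - p y u|) + N <= _); last first.
    by rewrite lerD2r ler_wpM2l.
  rewrite !cardD -big_split natr_sum mulr_sumr /N -sum1_card natr_sum -big_split /=.
  apply: ler_sum => u _; rewrite -[M%:R]ger0_norm // -normrM mulrBr.
  have := (a_le x u, a_gt x u, a_le y u, a_gt y u).
  case=> -[] [] ax1 ax2 ay1 ay2.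
  have [xy|yx] := leqP (a x u) (a y u).
    rewrite (_ : (a x u - a y u = 0)%N) ?add0n; last by apply/eqP; rewrite subn_eq0.
    rewrite natrB // distrC; apply: le_trans (_ : M%:R * p y u - M%:R * p x u + 1 <= _).
      lra.
    by rewrite lerD2r ler_norm.
  rewrite (_ : (a y u - a x u = 0)%N) ?addn0; last by apply/eqP; rewrite subn_eq0 ltnW.
  rewrite natrB ?(ltnW yx) //.
  apply: le_trans (_ : M%:R * p x u - M%:R * p y u + 1 <= _); first lra.
  by rewrite lerD2r ler_norm.
have MN0 : 0 < M%:R - N by nra.
have A_ne x : exists z, z \in A x.
  by apply/set0Pn; rewrite -card_gt0 -(ltr0n R); apply: lt_le_trans (cardA x).
exists {perm (U * 'I_M)%type}.
(* The default [v0] is taken from some [A x], so an empty [T] is treated apart. *)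
have [x0|noT] := pselect (inhabited T); last first.
  have noT' (x : T) : False by apply: noT.
  exists (fun _ x => False_rect _ (noT' x)); split => [|w x|x]; try by case: (noT' x).
  by rewrite (cardD1 1%g).
case: x0 => x0; have [v0 _] := A_ne x0.
exists (fun s x => (argmin s (A x) v0).1); split.
- by rewrite (cardD1 1%g).
- move=> s x; have [z /(argmin_in s v0)] := A_ne x.
  rewrite inE; apply: contraTneq => px0.
  by rewrite /a px0 mulr0 truncn0.
- move=> x y /cardS xy.
  have := card_argmin_neq (A x) (A y) v0.
  set D := #|[set s | _]|; set E := #|_ :|: (_ :\: _)| in xy *.
  set W := #|{: {perm _}}| => DW.
  have le1 : (#|[set s : {perm _} | (argmin s (A x) v0).1 != (argmin s (A y) v0).1]|
              <= D)%N.
    apply/subset_leq_card/fintype.subsetP => s; rewrite !inE.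
    by apply: contraNneq => ->.
  apply: (@le_trans _ _ D%:R); first by rewrite ler_nat.
  have le2 : D%:R * (M%:R - N) <= E%:R * W%:R :> R.
    apply: (@le_trans _ _ (D * #|A x :|: A y|)%:R); last by rewrite -natrM ler_nat.
    rewrite natrM ler_wpM2l //; apply: le_trans (cardA x) _.
    by rewrite ler_nat subset_leq_card // finset.subsetUl.
  have le3 : E%:R * W%:R <= (2 * eps * (M%:R - N)) * W%:R.
    by rewrite ler_wpM2r //; apply: le_trans xy _; lra.
  by rewrite -(ler_pM2r MN0) mulrAC; apply: le_trans le2 le3.
Qed.

End Rounding.

Local Open Scope classical_set_scope.

(** * Inverse semigroups *)

Section InverseSemigroupTheory.
Local Open Scope group_scope.
Variable S : inverseSemigroupType.
Implicit Types s t u v e f x y : S.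

Lemma sinvK : involutive (@sinv S).
Proof. by move=> s; symmetry; apply: sinv_uniq; rewrite ?mulsVs ?mulVsV. Qed.

Lemma sinv_idem e : idempotents e -> sinv e = e.
Proof. by rewrite /idempotents /= => ee; symmetry; apply: sinv_uniq; rewrite !ee. Qed.

(* The inverse of [e * f] equals [f * sinv (e * f) * e], which is idempotent,
   hence so is [e * f] itself. *)
Lemma idem_mul e f : idempotents e -> idempotents f -> idempotents (e * f).
Proof.
rewrite /idempotents /= => ee ff; pose a := e * f; pose b := sinv a.
have aba : a * b * a = a by exact: mulsVs.
have bab : b * a * b = b by exact: mulVsV.
have bE : f * b * e = b.
  apply: sinv_uniq.
  - rewrite -/a; transitivity (e * (f * f) * b * ((e * e) * f)).
      by rewrite /a !mulgA.
    by rewrite ee ff.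
  - transitivity (f * (b * ((e * e) * (f * f)) * b) * e).
      by rewrite /a !mulgA.
    by rewrite ee ff bab.
have bb : b * b = b.
  rewrite -[in LHS]bE; transitivity (f * (b * (e * f) * b) * e).
    by rewrite !mulgA.
  by rewrite bab.
have ab : a = b by rewrite -[LHS]sinvK -/b sinv_idem.
by rewrite -/a ab.
Qed.

(** Both products are idempotent, hence self-inverse, and [f * e] is an inverse of [e * f]; inverses
    are unique. *)
Lemma idemC e f : idempotents e -> idempotents f -> e * f = f * e.
Proof.
move=> ee ff; have ief := idem_mul ee ff; have ife := idem_mul ff ee.
rewrite -[LHS](sinv_idem ief); symmetry; apply: sinv_uniq.
- transitivity (e * (f * f) * (e * e) * f); first by rewrite !mulgA.
  by rewrite ee ff -[X in _ = X]ief !mulgA.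
- transitivity (f * (e * e) * (f * f) * e); first by rewrite !mulgA.
  by rewrite ee ff -[X in _ = X]ife !mulgA.
Qed.

Lemma sinvM s t : sinv (s * t) = sinv t * sinv s.
Proof.
symmetry; apply: sinv_uniq.
- transitivity (s * ((t * sinv t) * (sinv s * s)) * t); first by rewrite !mulgA.
  rewrite (idemC (idem_mulsV t) (idem_mulVs s)).
  transitivity ((s * sinv s * s) * (t * sinv t * t)); first by rewrite !mulgA.
  by rewrite !mulsVs.
- transitivity (sinv t * ((sinv s * s) * (t * sinv t)) * sinv s).
    by rewrite !mulgA.
  rewrite (idemC (idem_mulVs s) (idem_mulsV t)).
  transitivity ((sinv t * t * sinv t) * (sinv s * s * sinv s)).
    by rewrite !mulgA.
  by rewrite !mulVsV.
Qed.

(** This form makes compatibility with left multiplication immediate. From right to left, the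
    idempotents of [s] and [t] absorb each other and commute, hence coincide. *)
Lemma greenRP s t : greenR s t <-> exists x y, t = s * x /\ s = t * y.
Proof.
split=> [st|[x [y [tE sE]]]].
- exists (sinv s * t), (sinv t * s); split.
  + by rewrite mulgA st mulsVs.
  + by rewrite mulgA -st mulsVs.
- have st : s * sinv s * (t * sinv t) = t * sinv t.
    by rewrite mulgA {1}tE !mulgA mulsVs -tE.
  have ts : t * sinv t * (s * sinv s) = s * sinv s.
    by rewrite mulgA {1}sE !mulgA mulsVs -sE.
  by rewrite /greenR -ts -[RHS]st; apply: idemC; apply: idem_mulsV.
Qed.

Lemma greenR_sym s t : greenR s t -> greenR t s.
Proof. by rewrite /greenR => ->. Qed.

Lemma greenR_trans s t u : greenR s t -> greenR t u -> greenR s u.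
Proof. by rewrite /greenR => ->. Qed.

Lemma greenR_mull x s t : greenR s t -> greenR (x * s) (x * t).
Proof.
move=> /greenRP[y [z [tE sE]]]; apply/greenRP; exists y, z.
by rewrite -!mulgA -tE -sE.
Qed.

(** Right multiplication only descends among R-classes, so a product that ends in the class of [s]
    cannot have left it on the way. *)
Lemma greenR_prefix s u v : greenR s (s * (u * v)) -> greenR s (s * u).
Proof.
move=> /greenRP[y [z [_ sE]]]; apply/greenRP; exists u, (v * z); split=> //.
by rewrite {1}sE !mulgA.
Qed.

(** Reversibility of right multiplication inside an R-class, which gives the symmetry of the word
    metric. Commuting idempotents turns the left side into [(s * u) * sinv (s * u) * s]. *)
Lemma greenR_mulV s u : greenR s (s * u) -> s * u * sinv u = s.
Proof.
rewrite /greenR sinvM => su.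
transitivity (s * ((sinv s * s) * (u * sinv u))); first by rewrite !mulgA mulsVs.
rewrite (idemC (idem_mulVs s) (idem_mulsV u)).
transitivity (s * u * (sinv u * sinv s) * s); first by rewrite !mulgA.
by rewrite -su mulsVs.
Qed.

Lemma greenR_idem s e : idempotents e -> greenR s (s * e) -> s * e = s.
Proof.
move=> ie /greenR_mulV; rewrite (sinv_idem ie) -mulgA.
by move: (ie); rewrite /idempotents /= => ->.
Qed.

End InverseSemigroupTheory.

(** * The word metric *)

Section GradedMetric.
Local Open Scope ereal_scope.
Variables (R : realType) (X : choiceType) (D : nat -> X -> X -> Prop).

(** [D n] is meant as being joined by a path of length exactly [n], so it need not be monotone in
    [n]. *)
Definition graded_dist (x y : X) : \bar R :=
  match pselect (exists n, `[<D n x y>]) with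
  | left h => (ex_minn h)%:R%:E
  | right _ => +oo
  end.

Lemma graded_distP x y :
  (graded_dist x y = +oo /\ forall n, ~ D n x y) \/
  exists n, [/\ graded_dist x y = n%:R%:E, D n x y
              & forall m, D m x y -> (n <= m)%N].
Proof.
rewrite /graded_dist; case: pselect => [h|h]; [right|left].
- case: ex_minnP => n /asboolP Dn min; exists n; split=> // m Dm.
  by apply: min; apply/asboolP.
- by split=> // n Dn; apply: h; exists n; apply/asboolP.
Qed.

Lemma graded_dist_le n x y : D n x y -> graded_dist x y <= n%:R%:E.
Proof.
move=> Dn; have [[_ /(_ n)//]|[m [-> _ min]]] := graded_distP x y.
by rewrite lee_fin ler_nat; apply: min.
Qed.

Lemma graded_dist_lt x y : graded_dist x y < +oo <-> exists n, D n x y.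
Proof.
split=> [|[n /graded_dist_le h]]; last exact: le_lt_trans h (ltry _).
by have [[-> _]|[n [_ Dn _]]] := graded_distP x y; [rewrite ltxx|exists n].
Qed.

Hypothesis D0 : forall x y, D 0 x y <-> x = y.
Hypothesis Dsym : forall n x y, D n x y -> D n y x.
Hypothesis Dtrans : forall m n x y z, D m x y -> D n y z -> D (m + n) x z.

Lemma graded_dist_ext_metric : extended_metric graded_dist.
Proof.
split.
- move=> x y; have [[-> _]|[n [-> _ _]]] := graded_distP x y => //.
- move=> x y; split=> [|->].
  + have [[-> _]//|[n [-> Dn _]]] := graded_distP x y.
    by case=> /eqP; rewrite pnatr_eq0 => /eqP n0; apply/D0; rewrite -n0.
  + apply/eqP; rewrite eq_le; apply/andP; split.
      by apply: (@graded_dist_le 0); apply/D0.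
    by have [[-> _]|[n [-> _ _]]] := graded_distP y y.
- suff le x y : graded_dist x y <= graded_dist y x.
    by move=> x y; apply/eqP; rewrite eq_le !le.
  have [[-> _]|[n [-> Dn _]]] := graded_distP y x; first by rewrite leey.
  exact/graded_dist_le/Dsym.
- move=> x y z.
  have [[-> _]|[m [-> Dm _]]] := graded_distP x y.
    have [[-> _]|[n [-> _ _]]] := graded_distP y z; exact: leey.
  have [[-> _]|[n [-> Dn _]]] := graded_distP y z; first exact: leey.
  by rewrite -EFinD -natrD; apply/graded_dist_le/Dtrans/Dn.
Qed.

Lemma graded_dist_discrete : uniformly_discrete graded_dist.
Proof.
exists 1%R => // x y xy.
have [[-> _]|[[|n] [-> Dn _]]] := graded_distP x y; first exact: leey.
- by move/D0: Dn.
- by rewrite lee_fin ler1n.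
Qed.

End GradedMetric.

Section StandardMetric.
Local Open Scope group_scope.
Variables (R : realType) (S : inverseSemigroupType) (X : set S) (i : S -> nat).
Implicit Types s t u v e f x y : S.

(** The shift by one gives every word positive length. With [i] injective on [X], only finitely many
    letters have a given length. *)
Inductive word : nat -> S -> Prop :=
| word_gen x : X x -> word (i x).+1 x
| word_inv x : X x -> word (i x).+1 (sinv x)
| word_mul m n u v : word m u -> word n v -> word (m + n) (u * v).

Lemma word_gt0 n u : word n u -> (0 < n)%N.
Proof. by elim=> // m k v w _ m0 _ k0; rewrite addn_gt0 m0. Qed.

Lemma word_sinv n u : word n u -> word n (sinv u).
Proof.
elim=> [x|x|m k v w _ vm _ wk]; first exact: word_inv.
  by rewrite sinvK; apply: word_gen.
by rewrite sinvM addnC; apply: word_mul.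
Qed.

Hypothesis i_inj : {in X &, injective i}.

(** A word of length [n] is a letter, an inverse letter or a product of two words of smaller
    positive lengths, so strong induction applies. *)
Lemma finite_word n : finite_set [set u | word n u].
Proof.
elim/ltn_ind: n => n IH.
pose A := [set x | X x /\ (i x < n)%N].
have finA : finite_set A.
  have iA : {in A &, injective i}.
    by move=> x y; rewrite !inE => -[Xx _] [Xy _]; apply: i_inj; rewrite inE.
  rewrite -(eq_finite_set (inj_card_eq iA)).
  apply: (@sub_finite_set _ _ `I_n); last exact: finite_II.
  by move=> _ [x [_ xn] <-].
pose B := \bigcup_(m in [set m | (0 < m < n)%N])
  [set u * v | u in [set u | word m u] & v in [set v | word (n - m) v]].
apply: (@sub_finite_set _ _ (A `|` [set sinv x | x in A] `|` B)).
  move=> u /= nu; rewrite /A /B; case: nu {IH A B finA} => [x Xx|x Xx|m k v w mv kw].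
  - by left; left; split.
  - by left; right; exists x; split.
  - right; exists m => /=.
      by rewrite (word_gt0 mv) -[X in (X < _)%N]addn0 ltn_add2l (word_gt0 kw).
    by exists v => //; exists w => //=; rewrite addKn.
rewrite !finite_setU; split; first by split=> //; apply: finite_image.
apply: bigcup_finite.
  by apply: (@sub_finite_set _ _ `I_n) (finite_II n) => m /= /andP[].
move=> m /= /andP[m0 mn]; apply: finite_image2; first exact: IH.
by apply: IH; rewrite ltn_subrL m0 (ltn_trans m0 mn).
Qed.

(** Length 0 is a separate case because [S] has no unit to serve as the empty word. The condition
    [greenR s t] keeps steps inside R-classes. *)
Definition word_step n s t : Prop :=
  (n = 0 /\ s = t) \/ (exists u, [/\ word n u, t = s * u & greenR s t]).

Lemma word_step0 s t : word_step 0 s t <-> s = t.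
Proof.
by split=> [[[_ ->]//|[u [/word_gt0]]]//|->]; left.
Qed.

Lemma word_step_sym n s t : word_step n s t -> word_step n t s.
Proof.
case=> [[-> ->]|[u [nu -> su]]]; [by left|right].
exists (sinv u); split; [exact: word_sinv| |exact: greenR_sym].
by rewrite greenR_mulV.
Qed.

Lemma word_step_trans m n s t u :
  word_step m s t -> word_step n t u -> word_step (m + n) s u.
Proof.
case=> [[-> ->]//|[v [mv tE st]]] [[-> <-]|[w [nw uE tu]]].
  by right; exists v; rewrite addn0.
right; exists (v * w); split; first exact: word_mul.
- by rewrite uE tE mulgA.
- exact: greenR_trans tu.
Qed.

Lemma word_step_mull n x s t : word_step n s t -> word_step n (x * s) (x * t).
Proof.
case=> [[-> ->]|[u [nu tE st]]]; [by left|right].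
by exists u; split; [|rewrite tE mulgA|exact: greenR_mull].
Qed.

Lemma word_step_greenR n s t : word_step n s t -> greenR s t.
Proof. by case=> [[_ ->]|[u []]]. Qed.

Hypothesis X_gen : smallest (@inverse_subsemigroup S) (X `|` @idempotents S) = setT.

(* Idempotents act trivially along an R-class, so they can be dropped. *)
Lemma greenR_word_step s t : greenR s t -> exists n, word_step n s t.
Proof.
pose C := [set u | forall s, greenR s (s * u) -> exists n, word_step n s (s * u)].
(* Carrying [sinv u] along makes closure under [sinv] immediate. The conclusion then applies [C] to
   [sinv s * t], which moves [s] to [t]. *)
pose C2 := [set u | C u /\ C (sinv u)].
have Cmul u v : C u -> C v -> C (u * v).
  move=> Cu Cv r ruv; have ru := greenR_prefix ruv.
  have [m rm] := Cu _ ru.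
  have [|n rn] := Cv (r * u).
    by rewrite -mulgA; apply: greenR_trans ruv; apply: greenR_sym.
  by exists (m + n)%N; rewrite mulgA; apply: word_step_trans rn.
have Cword n u : word n u -> C u.
  by move=> nu r ru; exists n; right; exists u.
have Cidem e : idempotents e -> C e.
  by move=> ie r /(greenR_idem ie) ->; exists 0%N; left.
have /(_ (sinv s * t)) C2T : forall u, C2 u.
  move=> u; have : [set: S] u by [].
  rewrite -X_gen; apply; split.
  - split=> [v w [Cv Cv'] [Cw Cw']|v [Cv Cv']].
    + by split; [exact: Cmul|rewrite sinvM; exact: Cmul].
    + by split; rewrite ?sinvK.
  - move=> x [Xx|ix]; split.
    + exact: Cword (word_gen Xx).
    + exact: Cword (word_inv Xx).
    + exact: Cidem.
    + by rewrite sinv_idem //; exact: Cidem.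
move=> st; case: C2T => /(_ s) + _; have -> : s * (sinv s * t) = t.
  by rewrite mulgA st mulsVs.
exact.
Qed.

Lemma word_dist_standard : standard_metric (graded_dist R word_step).
Proof.
split.
- apply: graded_dist_ext_metric; [exact: word_step0|exact: word_step_sym|].
  exact: word_step_trans.
- exact: graded_dist_discrete word_step0.
- move=> s t; rewrite graded_dist_lt.
  by split=> [[n /word_step_greenR]|/greenR_word_step].
- move=> s t x.
  have [[-> _]|[n [-> Dn _]]] := graded_distP R word_step s t.
    exact: leey.
  exact/graded_dist_le/word_step_mull.
(* The words of length at most [r], lengths being integers. *)
- move=> r r0; exists (\bigcup_(n in `I_(Num.truncn r).+1) [set u | word n u]).
    by apply: bigcup_finite => [|n _]; [exact: finite_II|exact: finite_word].
  move=> s t st.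
  have [[-> _]//|[n [-> Dn _]]] := graded_distP R word_step s t.
  rewrite lee_fin => nr.
  case: Dn => [[_ /st]//|[u [nu -> _]]]; exists u => //; exists n => //=.
  by rewrite ltnS truncn_ge_nat.
Qed.

End StandardMetric.

Lemma exists_standard_metric (R : realType) (S : inverseSemigroupType) :
  quasi_countable S -> exists d : S -> S -> \bar R, standard_metric d.
Proof.
move=> [X [/countable_injP[i iX] Xgen]].
by exists (graded_dist R (word_step X i)); apply: word_dist_standard.
Qed.

Local Open Scope ring_scope.

(** * Random maps to bounded components *)

Lemma l1norm_fset (R : realType) (X : choiceType) (A : {fset X}) (f : X -> R) :
  (forall x, f x <> 0 -> x \in A) -> l1norm f = (\sum_(x <- A) `|f x|)%:E.
Proof.
move=> fA; rewrite /l1norm.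
transitivity (\esum_(x in [set` A]) `|f x|%:E); last first.
  rewrite esum_fset //.
  by rewrite -sumEFin [RHS]fsbig_seq ?fset_uniq.
rewrite [RHS]esum_mkcond; apply: eq_esum => x _.
case: ifPn => // /negP xA; have [->|/eqP/fA xA'] := eqVneq (f x) 0.
  by rewrite normr0.
by case: xA; rewrite inE.
Qed.

Lemma size_card_le_II (X : choiceType) (A : set X) (n : nat) (s : seq X) :
  (A #<= `I_n)%card -> uniq s -> (forall x, x \in s -> A x) -> (size s <= n)%N.
Proof.
move=> An us sA; apply: leq_trans (geq_card_fset_set An).
apply: uniq_leq_size => // x /sA Ax.
by rewrite in_fset_set ?inE//; apply/finite_set_leP; exists n.
Qed.

Section LocalSampling.
Variables (R : realType) (X Y : choiceType).
Variables (dX : X -> X -> \bar R) (dY : Y -> Y -> \bar R) (f : X -> Y).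
Variables (r L eps : R) (N : nat) (xi : Y -> Y -> R).
Hypotheses (dX_metric : extended_metric dX) (dY_metric : extended_metric dY).
Hypothesis f_inj : forall x y, (dX x y < +oo)%E -> f x = f y -> x = y.
Hypotheses (r0 : 0 < r) (eps0 : 0 < eps).
Hypothesis ballN : forall y, (eball dY y L #<= `I_N)%card.
Hypothesis xi_ge0 : forall y z, 0 <= xi y z.
Hypothesis xi_norm : forall y, l1norm (xi y) = 1%E.
Hypothesis xi_supp : forall y z, xi y z <> 0 -> eball dY y L z.
Hypothesis xi_var : forall x y, (dX x y <= r%:E)%E ->
  (l1norm (fun z => xi (f x) z - xi (f y) z)%R <= eps%:E)%E.

(* A uniq path between points carrying the same label [u] embeds through [f] in
   the ball around [u], whence the bound on its length. *)
Lemma dist_connected (T : finType) (i : T -> X) (lab : T -> Y) (x y : T) :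
  injective i -> (forall t, xi (f (i t)) (lab t) != 0) ->
  connect (fun s t => `[< (dX (i s) (i t) <= r%:E)%E >] && (lab s == lab t)) x y ->
  (dX (i x) (i y) <= (N%:R * r)%R%:E)%E.
Proof.
move=> i_inj xi_lab; set e := (X in connect X); case: (dX_metric) => _ d0 dsym dtri.
(* Each edge costs at most [r], and the label is constant along a path. *)
have dpath z p : path e z p ->
    (dX (i z) (i (last z p)) <= ((size p)%:R * r)%R%:E)%E /\
    (forall t, t \in p -> (dX (i z) (i t) < +oo)%E /\ lab t = lab z).
  elim: p z => [|t p IH] z /=; first by move=> _; rewrite mul0r (d0 _ _).2.
  move=> /andP[/andP[/asboolP zt /eqP lab_zt] /IH[tlast tp]]; split.
    apply: le_trans (dtri _ (i t) _) _; rewrite -natr1 mulrDl mul1r addrC EFinD.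
    exact: leeD.
  move=> s; rewrite inE => /predU1P[->|/tp[ts ->]].
    by rewrite (le_lt_trans zt) ?ltry.
  split=> //; apply: le_lt_trans (dtri _ (i t) _) _.
  by rewrite lte_add_pinfty // (le_lt_trans zt) ?ltry.
move=> /connectP[p0 + ->]; case/shortenP => p ep up _.
have [dlast pP] := dpath _ _ ep.
apply: le_trans dlast _; rewrite lee_fin ler_pM2r // ler_nat.
have xpP t : t \in x :: p -> (dX (i x) (i t) < +oo)%E /\ lab t = lab x.
  by rewrite inE => /predU1P[->|/pP//]; rewrite (d0 _ _).2 ?ltry.
apply: (@leq_trans (size (map (f \o i) (x :: p)))); first by rewrite size_map /=.
apply: (size_card_le_II (ballN (lab x))).
  rewrite map_inj_in_uniq // => s t /xpP[xs _] /xpP[xt _] /= fst.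
  apply: i_inj; apply: f_inj fst; apply: le_lt_trans (dtri _ (i x) _) _.
  by rewrite dsym lte_add_pinfty.
move=> _ /mapP[t /xpP[_ <-] ->] /=.
by case: dY_metric => _ _ dYsym _; rewrite /eball /= dYsym; apply/xi_supp/eqP.
Qed.

(** Correlated sampling needs finite types, so it is applied to the points of [F] and to the finite
    union [A] of balls carrying the [xi (f x)]. For each outcome, [c w] sends a point of [F] to the
    root of its component and fixes all others. *)
Lemma local_sampling (F : {fset X}) :
  exists (W : finType) (c : W -> X -> X),
    [/\ (0 < #|W|)%N, forall w x, (dX x (c w x) <= (N%:R * r)%R%:E)%E
      & forall x y, x \in F -> y \in F -> (dX x y <= r%:E)%E ->
          #|[set w | c w x != c w y]%SET|%:R <= 2 * eps * #|W|%:R].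
Proof.
case: (dX_metric) => _ d0 dsym _.
have fin_ball y : finite_set (eball dY y L) by apply/finite_set_leP; exists N.
pose A := \bigcup_(x in [set` F]) eball dY (f x) L.
have finA : finite_set A by apply: bigcup_finite.
pose U := fset_set A.
have xiU x z : x \in F -> xi (f x) z <> 0 -> z \in U.
  by move=> xF /xi_supp zx; rewrite in_fset_set // inE; exists x.
pose p (x : F) (u : U) := xi (f (val x)) (val u).
have sumU (g : Y -> R) : (forall z, g z <> 0 -> z \in U) ->
    l1norm g = (\sum_(u : U) `|g (val u)|)%:E.
  by move=> gU; rewrite (l1norm_fset gU) big_seq_fsetE.
have [||W [lab [W0 lab_supp lab_var]]] := @correlated_sampling R F U p eps eps0.
- by move=> x u; apply: xi_ge0.
- move=> x; apply: EFin_inj; rewrite -(xi_norm (f (val x))) sumU.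
    by congr EFin; apply: eq_bigr => u _; rewrite ger0_norm.
  by move=> z; apply: xiU; apply: valP.
pose e w : rel F := fun s t =>
  `[< (dX (val s) (val t) <= r%:E)%E >] && (val (lab w s) == val (lab w t)).
have e_sym w : connect_sym (e w).
  by apply: sym_connect_sym => s t; rewrite /e dsym eq_sym.
exists W, (fun w x => if insub x is Some t then val (fingraph.root (e w) t) else x).
split=> // [w x|x y xF yF xy].
  case: insubP => [t _ <-|_]; last first.
    by rewrite (d0 _ _).2 // lee_fin mulr_ge0 ?(ltW r0).
  apply: (@dist_connected F val (fun t => val (lab w t))); first exact: val_inj.
    by move=> s; apply: lab_supp.
  exact: connect_root.
rewrite (insubT (fun x => x \in F) xF) (insubT (fun x => x \in F) yF) /=.
set s := Sub x xF; set t := Sub y yF.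
apply: le_trans (lab_var s t _).
  (* Close points with equal labels are adjacent, so they share a root. *)
  rewrite ler_nat; apply/subset_leq_card/fintype.subsetP => w; rewrite !inE.
  apply: contraNneq => lab_st; apply/eqP; congr val; apply/(fingraph.rootP (e_sym w)).
  by apply: connect1; rewrite /e lab_st eqxx andbT; apply/asboolP.
rewrite -lee_fin -(sumU (fun z => xi (f x) z - xi (f y) z)); first exact: xi_var.
move=> z xyz; have [x0|/eqP/(xiU _ _ xF)//] := eqVneq (xi (f x) z) 0.
by apply: (xiU _ _ yF) => y0; apply: xyz; rewrite x0 y0 subrr.
Qed.

End LocalSampling.

(** * Passage to the limit *)

Section Distribution.
Variables (R : realType) (W : finType) (X : choiceType).
Hypothesis W0 : (0 < #|W|)%N.
Implicit Type c : W -> X.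

(** The law of [c w] for [w] uniform in [W]. *)
Definition distr c (z : X) : R := (\sum_w (c w == z)%:R) / #|W|%:R.

Lemma distr_ge0 c z : 0 <= distr c z.
Proof. by rewrite divr_ge0 // sumr_ge0. Qed.

Lemma distr_supp c z : distr c z <> 0 -> exists w, c w = z.
Proof.
move=> cz; apply: contrapT => nz; apply: cz; rewrite /distr big1 ?mul0r // => w _.
by case: eqP => // cw; case: nz; exists w.
Qed.

Lemma sum_eq_fset (B : {fset X}) (a : X) :
  \sum_(z <- B) (a == z)%:R = (a \in B)%:R :> R.
Proof.
rewrite -natr_sum; congr (_%:R).
rewrite -(count_uniq_mem _ (fset_uniq B)) -sum1_count [RHS]big_mkcond /=.
by apply: eq_bigr => z _; rewrite eq_sym; case: eqP.
Qed.

Lemma sum_distr c (B : {fset X}) :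
  (forall w, c w \in B) -> \sum_(z <- B) distr c z = 1.
Proof.
move=> cB; rewrite -mulr_suml exchange_big /=.
rewrite (eq_bigr (fun=> 1)) => [|w _]; last by rewrite sum_eq_fset cB.
by rewrite sumr_const divff // pnatr_eq0 -lt0n.
Qed.

(** Coupling inequality: each [w] with [c w != c' w] contributes at most 2 to the l1 distance, and
    the others nothing. *)
Lemma distr_dist c c' (B : {fset X}) (eps : R) :
  #|[set w | c w != c' w]%SET|%:R <= eps * #|W|%:R ->
  \sum_(z <- B) `|distr c z - distr c' z| <= 2 * eps.
Proof.
move=> cc'; have WR : 0 < #|W|%:R :> R by rewrite ltr0n.
rewrite -(ler_pM2r WR) mulr_suml.
apply: (@le_trans _ _ (\sum_(z <- B) \sum_w `|(c w == z)%:R - (c' w == z)%:R|)).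
  apply: ler_sum => z _; rewrite -mulrBl normrM normfV (@ger0_norm _ #|W|%:R) //.
  by rewrite divfK ?gt_eqF // -sumrB ler_norm_sum.
rewrite exchange_big /= -mulrA; apply: le_trans (ler_wpM2l _ cc') => //.
rewrite -sum1dep_card natr_sum mulr_sumr [leRHS]big_mkcond /=.
apply: ler_sum => w _; have [->|_] /= := eqVneq (c w) (c' w).
  by rewrite big1 // => z _; rewrite subrr normr0.
apply: le_trans (_ : \sum_(z <- B) ((c w == z)%:R + (c' w == z)%:R) <= _).
  apply: ler_sum => z _; apply: le_trans (ler_normB _ _) _.
  by rewrite !ger0_norm.
by rewrite big_split /= !sum_eq_fset -natrD mulr1 ler_nat; case: (_ \in B); case: (_ \in B).
Qed.

End Distribution.

(** Compactness of the segment gives a cluster point, and an ultrafilter converges to each of its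
    cluster points. *)
Lemma ultra_bounded_cvg (R : realType) (T : Type) (U : set_system T) (g : T -> R)
    (a b : R) :
  UltraFilter U -> (forall t, a <= g t <= b) -> exists l : R, g @ U --> l.
Proof.
move=> Uu gab; have PU : ProperFilter U by exact: ultra_proper.
have gU : (g @ U) `[a, b]%classic 
  by apply: (@filterS _ U _ setT) filterT => t _ /=; rewrite in_itv /= gab.
have [l [_ lcl]] := @segment_compact R a b (g @ U) _ gU.
exists l => V Vl; case: (@in_ultra_setVsetC _ U (g @^-1` V) Uu) => // UV.
by have [t [+ Vt]] := lcl (~` V) V UV Vl; case.
Qed.

(** The required conditions are closed, hence survive pointwise limits. Balls being finite, each l1
    norm is a sum over a fixed finite set, so no mass escapes. *)
Lemma limit_of_samplings (R : realType) (X : choiceType) (d : X -> X -> \bar R)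
    (r L eps : R) :
  (forall x, finite_set (eball d x L)) ->
  (forall F : {fset X}, exists (W : finType) (c : W -> X -> X),
    [/\ (0 < #|W|)%N, forall w x, eball d x L (c w x)
      & forall x y, x \in F -> y \in F -> (d x y <= r%:E)%E ->
          #|[set w | c w x != c w y]%SET|%:R <= eps * #|W|%:R]) ->
  exists xi : X -> X -> R,
    [/\ forall x y, 0 <= xi x y,
        forall x, l1norm (xi x) = 1%E,
        forall x y, (d x y <= r%:E)%E ->
          (l1norm (fun z => xi x z - xi y z)%R <= (2 * eps)%:E)%E
      & forall x y, xi x y <> 0 -> eball d x L y].
Proof.
move=> fin_ball samplings; pose B x := fset_set (eball d x L).
have BE x z : eball d x L z -> z \in B x by rewrite in_fset_set // inE.
have [q qP] : exists q : {fset X} -> X -> X -> R, forall F,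
    [/\ forall x z, 0 <= q F x z, forall x z, q F x z <> 0 -> eball d x L z,
        forall x, \sum_(z <- B x) q F x z = 1
      & forall x y A, x \in F -> y \in F -> (d x y <= r%:E)%E ->
          \sum_(z <- A : {fset X}) `|q F x z - q F y z| <= 2 * eps].
  suff: forall F : {fset X}, exists q : X -> X -> R,
    [/\ forall x z, 0 <= q x z, forall x z, q x z <> 0 -> eball d x L z,
        forall x, \sum_(z <- B x) q x z = 1
      & forall x y A, x \in F -> y \in F -> (d x y <= r%:E)%E ->
          \sum_(z <- A : {fset X}) `|q x z - q y z| <= 2 * eps].
    by move=> /choice[q qP]; exists q.
  move=> F; have [W [c [W0 cL cvar]]] := samplings F.
  exists (fun x => distr R (fun w => c w x)); split.
  - by move=> x z; apply: distr_ge0.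
  - by move=> x z /(@distr_supp R W X) [w <-].
  - by move=> x; apply: sum_distr => // w; apply/BE/cL.
  - by move=> x y A xF yF xy; apply: distr_dist => //; apply: cvar.
(* Generated by the sets of all [F] containing a given finite set, so that any finite set of points
   eventually lies in [F]. *)
pose Fil : set_system {fset X} :=
  filter_from setT (fun A : {fset X} => [set F | fsubset A F]).
have Fil_proper : ProperFilter Fil.
  apply: filter_from_proper; last by move=> A _; exists A => /=.
  apply: filter_from_filter; first by exists fset0.
  move=> A A' _ _; exists (A `|` A')%fset => // F /=.
  by rewrite fsubUset => /andP[].
have [U [Uu FU]] := ultraFilterLemma Fil_proper.
have PU : ProperFilter U by exact: ultra_proper.
have q_le1 F x z : 0 <= q F x z <= 1.
  have [q0 qL q1 _] := qP F; rewrite q0 /=.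
  have [->//|/eqP/qL/BE zB] := eqVneq (q F x z) 0.
  by rewrite -(q1 x) (big_fsetD1 _ zB) /= lerDl sumr_ge0.
have [xi qxi] : exists xi : X -> X -> R, forall x z, q F x z @[F --> U] --> xi x z.
  suff: forall x, exists xi : X -> R, forall z, q F x z @[F --> U] --> xi z.
    by move=> /choice[xi xiP]; exists xi.
  move=> x; suff: forall z, exists l : R, q F x z @[F --> U] --> l.
    by move=> /choice[xi xiP]; exists xi.
  by move=> z; apply: ultra_bounded_cvg => F; apply: q_le1.
have xi_supp x z : xi x z <> 0 -> eball d x L z.
  move=> xi0; apply: contrapT => nz; apply: xi0.
  have q0 F : q F x z = 0.
    by have [_ qL _ _] := qP F; apply: contrapT => /qL.
  apply/eqP; rewrite eq_le; apply/andP; split.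
    by apply: (cvgr_to_le (qxi x z)); apply: nearW => F; rewrite q0.
  by apply: (cvgr_to_ge (qxi x z)); apply: nearW => F; rewrite q0.
have xi_ge0 x z : 0 <= xi x z.
  by apply: (cvgr_to_ge (qxi x z)); apply: nearW => F; case/andP: (q_le1 F x z).
have cvg_sums (A : {fset X}) (g : {fset X} -> X -> R) (l : X -> R) :
    (forall z, g F z @[F --> U] --> l z) ->
    \sum_(z <- A) g F z @[F --> U] --> \sum_(z <- A) l z.
  by move=> gl; apply: cvg_big => // ; exact: add_continuous.
exists xi; split=> //.
- move=> x; rewrite (@l1norm_fset _ _ (B x)); last by move=> z /xi_supp/BE.
  congr EFin; rewrite (eq_bigr (xi x)); last by move=> z _; rewrite ger0_norm.
  have qs := cvg_sums (B x) _ _ (qxi x).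
  apply/eqP; rewrite eq_le; apply/andP; split.
    by apply: (cvgr_to_le qs); apply: nearW => F; have [_ _ ->] := qP F.
  by apply: (cvgr_to_ge qs); apply: nearW => F; have [_ _ ->] := qP F.
- move=> x y xy; rewrite (@l1norm_fset _ _ (B x `|` B y)%fset); last first.
    move=> z xyz; rewrite in_fsetU; have [x0|/eqP/xi_supp/BE->//] := eqVneq (xi x z) 0.
    apply/orP; right; apply/BE/xi_supp => y0.
    by apply: xyz; rewrite x0 y0 subrr.
  rewrite lee_fin.
  have qs : \sum_(z <- (B x `|` B y)%fset) `|q F x z - q F y z| @[F --> U] -->
            \sum_(z <- (B x `|` B y)%fset) `|xi x z - xi y z|.
    by apply: cvg_sums => z; apply: cvg_norm; apply: cvgB; apply: qxi.
  (* The bound holds as soon as [F] contains both [x] and [y]. *)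
  apply: (cvgr_to_le qs); apply: FU; exists [fset x; y]%fset => // F /fsubsetP xyF.
  have [_ _ _ qvar] := qP F.
  by apply: qvar => //; apply: xyF; rewrite !inE eqxx ?orbT.
Qed.

(** * Standard metrics, and transfer from the group to the semigroup *)

Lemma proper_bounded_geometry (R : realType) (S : inverseSemigroupType)
    (d : S -> S -> \bar R) : proper_metric d -> bounded_geometry d.
Proof.
move=> dproper r r0; have [F /finite_seqP[s ->] yF] := dproper r (ltW r0).
(* The ball lies in {x} ∪ xF; the extra 1 counts the centre. *)
exists (size s).+1 => x; pose t := x :: [seq (x * f)%g | f <- s].
have sub : eball d x r `<=` [set nth x t i | i in `I_(size s).+1].
  move=> y xy; have yt : y \in t.
    rewrite inE; have [//|/eqP yx] := eqVneq y x.
    by have [f fs ->] := yF _ _ (nesym yx) xy; rewrite map_f.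
  exists (index y t); last exact: nth_index.
  by move: yt; rewrite -index_mem {2}/t /= size_map.
exact: card_le_trans (subset_card_le sub) (card_image_le _ _).
Qed.

(** Close distinct points satisfy y = xf with [f] in a finite set. Left subinvariance bounds the
    distance of their images by that from the unit to the image of [f], which is finite because a
    group is a single R-class. *)
Lemma to_group_lipschitz (R : realType) (S : inverseSemigroupType)
    (d : S -> S -> \bar R)
    (dG : max_group_image S -> max_group_image S -> \bar R) (r : R) :
  proper_metric d -> standard_metric dG -> 0 <= r ->
  exists2 r' : R, 0 < r' & forall x y, (d x y <= r%:E)%E ->
    (dG (to_group x) (to_group y) <= r'%:E)%E.
Proof.
move=> dproper [[dG_ge0 dG0 _ _] _ dGcomp dGsub _] /dproper[F /finite_seqP[s ->] yF].
pose l f := dG (to_group (f * sinv f)%g) (to_group f).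
have lfin f : l f \is a fin_num.
  rewrite ge0_fin_numE ?dG_ge0 // dGcomp.
  by have [] := max_group_image_group (to_group (f * sinv f)%g) (to_group f).
have l_ge0 f : 0 <= fine (l f) by rewrite fine_ge0 ?dG_ge0.
(* The sum dominates each [l f]; the 1 ensures positivity. *)
exists (1 + \sum_(f <- s) fine (l f)).
  by rewrite ltr_pwDl // sumr_ge0.
move=> x y xy; have [<-|/eqP yx] := eqVneq x y.
  by rewrite (dG0 _ _).2 // lee_fin addr_ge0 // sumr_ge0.
have [f fs ->] := yF _ _ yx xy.
apply: le_trans (_ : (l f <= _)%E).
  rewrite -[X in dG X](mgi_mulr1 (to_group x) (idem_mulsV f)) (to_groupM x f).
  exact: dGsub.
rewrite -(fineK (lfin f)) lee_fin (big_rem f fs) /=.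
by rewrite addrCA lerDl addr_ge0 // sumr_ge0.
Qed.

Theorem corollary3p5 (R : realType) (S : inverseSemigroupType)
    (hq : quasi_countable S) (hE : E_unitary S)
    (hA : has_property_A R (max_group_image S)) :
  has_property_A R S.
Proof.
have [dG [dG_std [dG_metric _ dG_bg dG_A]]] := hA.
have [d d_std] := exists_standard_metric R hq.
have [d_metric d_disc d_comp _ d_proper] := d_std.
have d_bg := proper_bounded_geometry d_proper.
exists d; split=> //; split=> // eps r eps0 r0.
have [r' r'0 lip] := to_group_lipschitz d_proper dG_std (ltW r0).
(* One factor 2 is lost in correlated sampling, another in passing from disagreement probability to
   l1 distance. *)
have eps4 : 0 < eps / 4 by rewrite divr_gt0.
have [L L0 [xi [xi_ge0 xi_norm xi_var xi_supp]]] := dG_A _ _ eps4 r'0.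
have [N ballN] := dG_bg L L0.
have L'0 : 0 < N%:R * r + 1 by rewrite ltr_wpDl // mulr_ge0 // ltW.
exists (N%:R * r + 1) => //.
have -> : eps = 2 * (2 * (eps / 4)) by field.
apply: limit_of_samplings => [x|F].
  by have [n /(_ x) xn] := d_bg _ L'0; apply/finite_set_leP; exists n.
have [||W [c [W0 cN cvar]]] := @local_sampling R S _ d dG (@to_group S) r L
  (eps / 4) N xi d_metric dG_metric _ r0 eps4 ballN xi_ge0 xi_norm xi_supp _ F.
- by move=> x y /d_comp; apply: hE.
- by move=> x y /lip; apply: xi_var.
exists W, c; split=> // w x; apply: le_trans (cN w x) _.
by rewrite lee_fin lerDl.
Qed.
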